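(* For $1\le i\le 17$ let $C_i^{(\mathrm{Dege})}=V(Q^{(\mathrm{Dege})},P_i^{(\mathrm{Dege})})\subset\mathbb{P}^3$ be the superspecial curve of genus $4$ over $\mathbb{F}_{11}$ defined by $Q^{(\mathrm{Dege})}=2yw+z^2$ and the cubic form $P_i^{(\mathrm{Dege})}$ listed in the context. Write $A_i=\operatorname{Aut}_{\mathbb{F}_{11}}(C_i^{(\mathrm{Dege})})$. Then (1) $A_1\cong \mathrm{C}_2\times\mathrm{C}_2$; (2) $A_2\cong \mathrm{C}_2\times\mathrm{C}_2$; (3) $A_3\cong \mathrm{C}_2\times\mathrm{C}_2$; (4) $A_4\cong \mathrm{C}_2$; (5) $A_5\cong \mathrm{C}_2$; (6) $A_6\cong\{e\}$; (7) $A_7\cong \mathrm{C}_2$; (8) $A_8\cong\{e\}$; (9) $A_9\cong \mathrm{C}_6$; (10) $A_{10}\cong \mathrm{D}_6$; (11) $A_{11}\cong \mathrm{D}_6$; (12) $A_{12}\cong \mathrm{S}_4$; (13) $A_{13}\cong \mathrm{C}_4$; (14) $A_{14}\cong \mathrm{C}_2$; (15) $A_{15}\cong \mathrm{C}_6$; (16) $A_{16}\cong \mathrm{C}_3$; (17) $A_{17}\cong \mathrm{D}_4$.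
   Context: $\mathrm{C}_n$ is the cyclic group of order $n$, $\mathrm{D}_n$ the dihedral group of degree $n$ (order $2n$), $\mathrm{S}_n$ the symmetric group of degree $n$, $\{e\}$ the trivial group. The cubic forms in $\mathbb{F}_{11}[x,y,z,w]$ are: $P_1^{(\mathrm{Dege})}=x^3+y^3+w^3$, $P_2^{(\mathrm{Dege})}=x^3+y^3+2w^3$, $P_3^{(\mathrm{Dege})}=x^3+y^3+z^3+5w^3$, $P_4^{(\mathrm{Dege})}=x^3+xw^2+y^3$, $P_5^{(\mathrm{Dege})}=x^3+2xw^2+y^3$, $P_6^{(\mathrm{Dege})}=x^3+xzw+y^3+7z^3+w^3$, $P_7^{(\mathrm{Dege})}=x^3+xw^2+xyz+y^3+5z^3+4w^3$, $P_8^{(\mathrm{Dege})}=x^3+6xw^2+xyz+y^3+8z^3+8w^3$, $P_9^{(\mathrm{Dege})}=x^3+5y^3+2yz^2+z^3+zw^2+4w^3$, $P_{10}^{(\mathrm{Dege})}=x^3+y^3+8yz^2+z^2w+2w^3$, $P_{11}^{(\mathrm{Dege})}=x^3+2y^3+2yz^2+4z^3+z^2w+3w^3$, $P_{12}^{(\mathrm{Dege})}=x^3+2y^3+4yz^2+z^2w+10w^3$, $P_{13}^{(\mathrm{Dege})}=x^3+2y^3+4yz^2+z^3+z^2w+zw^2+7w^3$, $P_{14}^{(\mathrm{Dege})}=x^3+xy^2+7xyz+8xz^2+8xzw+2xw^2+2y^3+4yz^2+z^3+z^2w+zw^2+7w^3$, $P_{15}^{(\mathrm{Dege})}=x^3+5y^3+3yz^2+5z^3+z^2w+zw^2+10w^3$,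 $P_{16}^{(\mathrm{Dege})}=x^3+6y^3+2yz^2+6z^3+z^2w+zw^2+6w^3$, $P_{17}^{(\mathrm{Dege})}=x^3+10y^3+6yz^2+7z^3+z^2w+zw^2$. These curves are known to be nonsingular nonhyperelliptic superspecial curves of genus $4$ (canonically embedded). A curve is superspecial if its Jacobian is isomorphic over the algebraic closure to a product of supersingular elliptic curves. For $C=V(Q,P)$ over a field $K$, $\operatorname{Aut}_K(C)$ is the group of automorphisms of $C$ defined over $K$. It is described as $\operatorname{Aut}_K(C)=G_K/{\sim}$, where, with $\varphi$ the symmetric coefficient matrix of $Q$, $G_K=\{g\in \mathrm{GL}_4(K): {}^tg\varphi g=\mu\varphi\text{ for some }\mu\in K^\times,\ g\cdot P\equiv rP \bmod Q\text{ for some } r\in K^\times\}$, $g\cdot P:=P((x,y,z,w)\cdot{}^tg)$, and $g\sim cg$ for $c\in K^\times$. *)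

(* Defs.v *)
From HB Require Import structures.
From mathcomp Require Import all_boot all_order all_algebra all_fingroup all_solvable.
From mathcomp Require Import mpoly.
From mathcomp Require boolp.

Set Implicit Arguments.
Unset Strict Implicit.
Unset Printing Implicit Defensive.

Import GRing.Theory.
Local Open Scope ring_scope.

Section AutGroup.

Variable K : finFieldType.
Implicit Types (P Q : {mpoly K[4]}) (g : {'GL_4[K]}).

(* The i-th entry of the substituted tuple is that of (X_0, .., X_3) * g^T.   *)
Definition actp g P : {mpoly K[4]} :=
  P \mPo [tuple \sum_(j < 4) GLval g i j *: 'X_j | i < 4].

Definition congr_mod Q P1 P2 : Prop := exists R : {mpoly K[4]}, P1 - P2 = R * Q.

(* Symmetric coefficient matrix of a quadratic form in characteristic <> 2:   *)
(* an off-diagonal entry is half the coefficient of X_i X_j.                  *)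
Definition coef_mx Q : 'M[K]_4 :=
  \matrix_(i, j) (Q@_(U_(i) + U_(j)) / (if i == j then 1 else 2)).

Definition stabilizes Q P g : Prop :=
  (exists mu : K, mu != 0 /\
     (GLval g)^T *m coef_mx Q *m GLval g = mu *: coef_mx Q) /\
  (exists r : K, r != 0 /\ congr_mod Q (actp g P) (r *: P)).

Definition stab_GL Q P : {set {'GL_4[K]}} :=
  [set g | boolp.asbool (stabilizes Q P g)].

Definition scalar_GL : {set {'GL_4[K]}} :=
  [set g | [exists c : K, GLval g == c%:M]].

Lemma stab_GLP Q P g : reflect (stabilizes Q P g) (g \in stab_GL Q P).
Proof. by rewrite inE; apply: boolp.asboolP. Qed.

Lemma scalar_GLP g : reflect (exists c, GLval g = c%:M) (g \in scalar_GL).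
Proof.
rewrite inE; apply: (iffP existsP) => [[c /eqP]|[c gc]]; first by exists c.
by exists c; apply/eqP.
Qed.

Lemma scalar_GL_group_set : group_set scalar_GL.
Proof.
apply/group_setP; split=> [|g h /scalar_GLP[c gc] /scalar_GLP[d hd]].
  by apply/scalar_GLP; exists 1.
apply/scalar_GLP; exists (c * d).
by rewrite GL_MxE gc hd -scalar_mxM.
Qed.
Canonical scalar_GL_group := Group scalar_GL_group_set.

Lemma scalar_GL_normal : (scalar_GL <| [set: {'GL_4[K]}])%g.
Proof.
apply/andP; split; first exact: subsetT.
apply/subsetP=> x _; rewrite inE; apply/subsetP=> _ /imsetP[g /scalar_GLP[c gc] ->].
apply/scalar_GLP; exists c.
suff ->: (g ^ x = g)%g by [].
apply/conjg_fixP/commgP/val_inj.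
change (GLval g *m GLval x = GLval x *m GLval g).
by rewrite gc scalar_mxC.
Qed.


Lemma actpM g h P : actp (g * h)%g P = actp h (actp g P).
Proof.
rewrite {3}/actp comp_mpolyE {1}/actp comp_mpolyE [RHS]linear_sum.
apply: eq_bigr => m _ /=; rewrite [RHS]linearZ /=; congr (_ *: _).
rewrite rmorph_prod; apply: eq_bigr => i _.
rewrite rmorphXn /=; congr (_ ^+ _).
rewrite !tnth_mktuple linear_sum /=.
under [RHS]eq_bigr => j _ do rewrite linearZ /= comp_mpolyXU
   -tnth_nth tnth_mktuple scaler_sumr.
rewrite exchange_big; apply: eq_bigr => k _ /=.
rewrite mxE scaler_suml.
by apply: eq_bigr => j _; rewrite scalerA.
Qed.

Lemma actp1 P : actp 1%g P = P.
Proof.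
rewrite /actp -[RHS]comp_mpoly_id; congr (_ \mPo _).
apply: eq_mktuple => i; rewrite (bigD1 i) //= mxE eqxx scale1r big1 ?addr0 //.
by move=> j /negPf ji; rewrite mxE eq_sym ji scale0r.
Qed.

Definition qform (M : 'M[K]_4) : {mpoly K[4]} :=
  \sum_(i < 4) \sum_(j < 4) M i j *: ('X_i * 'X_j).

Lemma actp_qform g M : actp g (qform M) = qform ((GLval g)^T *m M *m GLval g).
Proof.
transitivity (\sum_(i < 4) \sum_(j < 4) \sum_(k < 4) \sum_(l < 4)
    (M i j * GLval g i k * GLval g j l) *: ('X_k * 'X_l : {mpoly K[4]})).
  rewrite /qform /actp linear_sum; apply: eq_bigr => i _.
  rewrite linear_sum; apply: eq_bigr => j _ /=.
  rewrite linearZ rmorphM /= !comp_mpolyXU -!tnth_nth !tnth_mktuple.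
  rewrite big_distrlr /= scaler_sumr; apply: eq_bigr => k _.
  rewrite scaler_sumr; apply: eq_bigr => l _.
  by rewrite -scalerAl -scalerAr !scalerA.
under eq_bigr do rewrite exchange_big.
rewrite exchange_big; apply: eq_bigr => k _ /=.
under eq_bigr do rewrite exchange_big.
rewrite exchange_big; apply: eq_bigr => l _ /=.
rewrite mxE scaler_suml exchange_big; apply: eq_bigr => j _ /=.
rewrite mxE mulr_suml scaler_suml; apply: eq_bigr => i _ /=.
by rewrite mxE [M i j * _]mulrC.
Qed.

Lemma eq_mnm2 (i j k l : 'I_4) :
  ((U_(i) + U_(j))%MM == (U_(k) + U_(l))%MM) =
  all (fun m : nat => (i == m :> nat) + (j == m :> nat) ==
                      (k == m :> nat) + (l == m :> nat))%N (iota 0 4).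
Proof.
apply/eqP/allP=> [eq_ijkl m | eq_ijkl]; last first.
  apply/mnmP=> m; rewrite !mnmDE !mnm1E; apply/eqP.
  by apply: (eq_ijkl (val m)); rewrite mem_iota /= ltn_ord.
rewrite mem_iota => /andP[_ lt_m4].
by move/mnmP/(_ (Ordinal lt_m4)): eq_ijkl; rewrite !mnmDE !mnm1E => /eqP.
Qed.

Lemma cone_qform (Q := 2 * 'X_(@Ordinal 4 1 isT) * 'X_(@Ordinal 4 3 isT) +
    'X_(@Ordinal 4 2 isT) ^+ 2 : {mpoly K[4]}) :
  2 != 0 :> K -> Q = qform (coef_mx Q).
Proof.
move=> nz2.
have defQ : Q = 2 *: 'X_[U_(@Ordinal 4 1 isT) + U_(@Ordinal 4 3 isT)]
                + 'X_[U_(@Ordinal 4 2 isT) + U_(@Ordinal 4 2 isT)].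
  by rewrite /Q !mpolyXD scaler_nat -mulrA mulr_natl.
rewrite /qform /coef_mx !big_ord_recl !big_ord0 /= !mxE [in RHS]defQ.
rewrite !mcoeffD !mcoeffZ !mcoeffX !eq_mnm2 /=.
rewrite !(mulr0, mulr1, add0r, addr0, mul0r, divff nz2, divr1, scale0r, scale1r).
have -> : lift ord0 (lift ord0 (lift ord0 ord0)) = @Ordinal 4 3 isT.
  by apply: val_inj.
have -> : lift ord0 (lift ord0 ord0) = @Ordinal 4 2 isT by apply: val_inj.
have -> : lift ord0 ord0 = @Ordinal 4 1 isT by apply: val_inj.
rewrite /Q -mulrA mulr_natl mulr2n expr2 [X in _ = _ + (_ + X)]mulrC.
by rewrite -addrA [X in _ + X]addrC.
Qed.

Lemma stab_GL_group_set Q P : Q = qform (coef_mx Q) -> group_set (stab_GL Q P).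
Proof.
move=> defQ; apply/group_setP; split=> [|g h].
  apply/stab_GLP; split; exists 1; split; rewrite ?oner_neq0 //.
    by rewrite scale1r GL_1E trmx1 mul1mx mulmx1.
  by exists 0; rewrite actp1 scale1r subrr mul0r.
case/stab_GLP=> -[mu [mu0 gQ]] [r [r0 [R gP]]].
case/stab_GLP=> -[nu [nu0 hQ]] [s [s0 [S hP]]].
apply/stab_GLP; split.
  exists (nu * mu); rewrite mulf_neq0 //; split=> //.
  rewrite GL_MxE trmx_mul -!mulmxA (mulmxA (coef_mx Q)) (mulmxA (GLval g)^T).
  by rewrite (mulmxA (GLval g)^T) gQ -scalemxAl -scalemxAr mulmxA hQ scalerA mulrC.
exists (r * s); rewrite mulf_neq0 //; split=> //.
have hQQ : actp h Q = nu *: Q.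
  rewrite {1}defQ actp_qform hQ [in RHS]defQ /qform scaler_sumr.
  apply: eq_bigr => i _; rewrite scaler_sumr; apply: eq_bigr => j _.
  by rewrite mxE scalerA.
exists (nu *: actp h R + r *: S).
have ->: actp (g * h)%g P = actp h R * actp h Q + r *: actp h P.
  rewrite actpM -(subrK (r *: P) (actp g P)) gP.
  by rewrite /actp comp_mpolyD comp_mpolyZ rmorphM.
rewrite -(subrK (s *: P) (actp h P)) hP hQQ scalerDr scalerA addrA addrK.
by rewrite mulrDl -!scalerAl -scalerAr.
Qed.

(* mathcomp's A / H is the image of 'N_A(H); here the normality condition is  *)
(* void by scalar_GL_normal, so this is stab_GL Q P modulo g ~ c g.           *)
Definition curve_aut Q P : {set coset_of scalar_GL} :=
  (stab_GL Q P / scalar_GL)%g.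

End AutGroup.

Section Dege.

Local Notation form := {mpoly 'F_11[4]}.
Local Notation x := ('X_(@Ordinal 4 0 isT) : form).
Local Notation y := ('X_(@Ordinal 4 1 isT) : form).
Local Notation z := ('X_(@Ordinal 4 2 isT) : form).
Local Notation w := ('X_(@Ordinal 4 3 isT) : form).

Definition Q_Dege : form := 2 * y * w + z ^+ 2.

Definition P1_Dege : form := x ^+ 3 + y ^+ 3 + w ^+ 3.
Definition P2_Dege : form := x ^+ 3 + y ^+ 3 + 2 * w ^+ 3.
Definition P3_Dege : form := x ^+ 3 + y ^+ 3 + z ^+ 3 + 5 * w ^+ 3.
Definition P4_Dege : form := x ^+ 3 + x * w ^+ 2 + y ^+ 3.
Definition P5_Dege : form := x ^+ 3 + 2 * x * w ^+ 2 + y ^+ 3.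
Definition P6_Dege : form := x ^+ 3 + x * z * w + y ^+ 3 + 7 * z ^+ 3 + w ^+ 3.
Definition P7_Dege : form :=
  x ^+ 3 + x * w ^+ 2 + x * y * z + y ^+ 3 + 5 * z ^+ 3 + 4 * w ^+ 3.
Definition P8_Dege : form :=
  x ^+ 3 + 6 * x * w ^+ 2 + x * y * z + y ^+ 3 + 8 * z ^+ 3 + 8 * w ^+ 3.
Definition P9_Dege : form :=
  x ^+ 3 + 5 * y ^+ 3 + 2 * y * z ^+ 2 + z ^+ 3 + z * w ^+ 2 + 4 * w ^+ 3.
Definition P10_Dege : form :=
  x ^+ 3 + y ^+ 3 + 8 * y * z ^+ 2 + z ^+ 2 * w + 2 * w ^+ 3.
Definition P11_Dege : form :=
  x ^+ 3 + 2 * y ^+ 3 + 2 * y * z ^+ 2 + 4 * z ^+ 3 + z ^+ 2 * w + 3 * w ^+ 3.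
Definition P12_Dege : form :=
  x ^+ 3 + 2 * y ^+ 3 + 4 * y * z ^+ 2 + z ^+ 2 * w + 10 * w ^+ 3.
Definition P13_Dege : form :=
  x ^+ 3 + 2 * y ^+ 3 + 4 * y * z ^+ 2 + z ^+ 3 + z ^+ 2 * w + z * w ^+ 2 + 7 * w ^+ 3.
Definition P14_Dege : form :=
  x ^+ 3 + x * y ^+ 2 + 7 * x * y * z + 8 * x * z ^+ 2 + 8 * x * z * w + 2 * x * w ^+ 2 +
    2 * y ^+ 3 + 4 * y * z ^+ 2 + z ^+ 3 + z ^+ 2 * w + z * w ^+ 2 + 7 * w ^+ 3.
Definition P15_Dege : form :=
  x ^+ 3 + 5 * y ^+ 3 + 3 * y * z ^+ 2 + 5 * z ^+ 3 + z ^+ 2 * w + z * w ^+ 2 + 10 * w ^+ 3.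
Definition P16_Dege : form :=
  x ^+ 3 + 6 * y ^+ 3 + 2 * y * z ^+ 2 + 6 * z ^+ 3 + z ^+ 2 * w + z * w ^+ 2 + 6 * w ^+ 3.
Definition P17_Dege : form :=
  x ^+ 3 + 10 * y ^+ 3 + 6 * y * z ^+ 2 + 7 * z ^+ 3 + z ^+ 2 * w + z * w ^+ 2.

Lemma Q_Dege_qform : Q_Dege = qform (coef_mx Q_Dege).
Proof. by apply: cone_qform. Qed.

Canonical stab_GL_Dege_group (P : form) :=
  Group (stab_GL_group_set P Q_Dege_qform).

End Dege.

(* Main.v *)
From HB Require Import structures.
From Stdlib Require Import ZArith Lia.
Require Import Defs.
From mathcomp Require Import all_boot all_order all_algebra all_fingroup all_solvable.
From mathcomp Require Import mpoly ssrZ zify ring.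

(* Each cubic is P = x^3 + x q(y, z, w) + c(y, z, w) with no term in x^2, and    *)
(* the singular point of the cone Q is the x-axis.  Hence an element of the      *)
(* stabilizer is a multiple of diag(1, M), where M maps the conic 2yw + z^2 = 0  *)
(* to itself and preserves the values of q and c on it.  Conversely, q and c     *)
(* restrict to binary forms of degrees 4 and 6 on the conic, so agreement at its *)
(* 12 points over F_11 already gives congruence modulo Q.  The group is thus the *)
(* finite set of the M that preserve these values; M is determined by the images *)
(* of three points, and all candidates are enumerated, in integers modulo 11.    *)

(** The vertex of the cone is the radical of $Q$, so every similitude of $Q$ preserves the line it
    spans ([cone_col0]). After scaling, the only freedom outside the block $M$ is $x \mapsto x +
    l(y,z,w)$. Since 3 is invertible, a value of $l$ that is nonzero at a point of the conic would
    create an $x^2$ term there, so $l$ vanishes on the conic and hence identically. This gives the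
    normal form of [stab_normal], and the corner entry 1 selects one representative of each class
    modulo scalars.

    Conversely, the conic is parametrized by $s \mapsto (1, s, 5s^2)$ and a point at infinity. A
    quadratic or cubic form vanishing at these points restricts to a polynomial of degree at most 6
    with 11 roots, so it is a multiple of $2yw + z^2$ ([quad_cone], [cub_cone]); hence [stab_mx4].

    The enumeration [autos] is complete ([autosP]), so its length bounds the order of the group from
    above ([card_aut]). Explicit matrices give a subgroup that already reaches this bound: the
    powers of one element ([aut_cyclic]), the group generated by two involutions ([aut_dihedral]),
    or a conjugate of the permutation matrices ([aut_symmetric]). For the trivial groups the bound 1
    is enough. *)

Set Implicit Arguments.
Unset Strict Implicit.
Unset Printing Implicit Defensive.

Import GRing.Theory.

(** * Ternary forms of degree 2 and 3 *)

Section TernaryForms.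

Local Open Scope ring_scope.

Variable R : comNzRingType.

Definition vec : Type := R * R * R.

(* A matrix is the triple of its columns. *)
Definition mat : Type := vec * vec * vec.

Implicit Types (a b d : R) (k : seq R) (v : vec) (M N : mat).

Definition quad k v := let: (y, z, w) := v in
  k`_0 * y ^+ 2 + k`_1 * (y * z) + k`_2 * (y * w) + k`_3 * z ^+ 2
  + k`_4 * (z * w) + k`_5 * w ^+ 2.

Definition cub k v := let: (y, z, w) := v in
  k`_0 * y ^+ 3 + k`_1 * (y ^+ 2 * z) + k`_2 * (y ^+ 2 * w)
  + k`_3 * (y * z ^+ 2) + k`_4 * (y * z * w) + k`_5 * (y * w ^+ 2)
  + k`_6 * z ^+ 3 + k`_7 * (z ^+ 2 * w) + k`_8 * (z * w ^+ 2) + k`_9 * w ^+ 3.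

Definition cone v := let: (y, z, w) := v in 2 * y * w + z ^+ 2.

(** Natural coefficients let the same form be read over the integers, over F_11 and over
    polynomials. Missing entries count as 0, so [[::]] is the zero form. *)
Definition nats (s : seq nat) : seq R := [seq n%:R | n <- s].

Definition cform (q c : seq nat) x v :=
  x ^+ 3 + x * quad (nats q) v + cub (nats c) v.

Definition vlin a v1 b v2 d v3 : vec :=
  let: (y1, z1, w1) := v1 in let: (y2, z2, w2) := v2 in
  let: (y3, z3, w3) := v3 in
  (a * y1 + b * y2 + d * y3, a * z1 + b * z2 + d * z3, a * w1 + b * w2 + d * w3).

Definition mapp M v := let: (m1, m2, m3) := M in let: (y, z, w) := v in
  vlin y m1 z m2 w m3.

Definition mmul M N := let: (n1, n2, n3) := N in
  (mapp M n1, mapp M n2, mapp M n3).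

Definition mid : mat := ((1, 0, 0), (0, 1, 0), (0, 0, 1)).

Definition mexp M n := iter n (mmul M) mid.

Definition vadd v1 v2 := vlin 1 v1 1 v2 0 v1.

Definition qpolar k v1 v2 := quad k (vadd v1 v2) - quad k v1 - quad k v2.

(** The derivative of the cubic at [v1] in the direction [v2]. It yields the mixed coefficients of a
    composite with no division by 2 or 6. *)
Definition cderiv k v1 v2 :=
  let: (y, z, w) := v1 in let: (y', z', w') := v2 in
  (3 * k`_0 * y ^+ 2 + 2 * k`_1 * y * z + 2 * k`_2 * y * w + k`_3 * z ^+ 2
    + k`_4 * z * w + k`_5 * w ^+ 2) * y' +
  (k`_1 * y ^+ 2 + 2 * k`_3 * y * z + k`_4 * y * w + 3 * k`_6 * z ^+ 2
    + 2 * k`_7 * z * w + k`_8 * w ^+ 2) * z' +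
  (k`_2 * y ^+ 2 + k`_4 * y * z + 2 * k`_5 * y * w + k`_7 * z ^+ 2
    + 2 * k`_8 * z * w + 3 * k`_9 * w ^+ 2) * w'.

Definition quad_comp k M := let: (m1, m2, m3) := M in
  [:: quad k m1; qpolar k m1 m2; qpolar k m1 m3; quad k m2; qpolar k m2 m3;
      quad k m3].

Definition cub_comp k M := let: (m1, m2, m3) := M in
  [:: cub k m1; cderiv k m1 m2; cderiv k m1 m3; cderiv k m2 m1;
      cderiv k (vadd m1 m2) m3 - cderiv k m1 m3 - cderiv k m2 m3;
      cderiv k m3 m1; cub k m2; cderiv k m2 m3; cderiv k m3 m2; cub k m3].

Lemma quad_mapp k M v : quad k (mapp M v) = quad (quad_comp k M) v.
Proof.
case: M v => [[[[a b] c] [[d e] f]] [[g h] i]] [[y z] w].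
rewrite /= /qpolar /vadd /=; ring.
Qed.

Lemma cub_mapp k M v : cub k (mapp M v) = cub (cub_comp k M) v.
Proof.
case: M v => [[[[a b] c] [[d e] f]] [[g h] i]] [[y z] w].
rewrite /= /vadd /=; ring.
Qed.

Lemma cone_quad v : cone v = quad (nats [:: 0; 0; 2; 1]%N) v.
Proof. by case: v => [[y z] w] /=; ring. Qed.

Definition csub n k1 k2 : seq R := mkseq (fun i => k1`_i - k2`_i) n.

Lemma quad_csub k1 k2 v : quad (csub 6 k1 k2) v = quad k1 v - quad k2 v.
Proof. by case: v => [[y z] w] /=; ring. Qed.

Lemma cub_csub k1 k2 v : cub (csub 10 k1 k2) v = cub k1 v - cub k2 v.
Proof. by case: v => [[y z] w] /=; ring. Qed.

(* The first eleven points are the affine points of the conic over F_11, where  *)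
(* 2 * 5 s^2 + s^2 = 0; the last one is its point at infinity.                  *)
Definition cpts : seq vec :=
  rcons [seq (1, s%:R, 5 * s%:R ^+ 2) | s <- iota 0 11] (0, 0, 1).

(* Equality is tested through z: mod 11 over Z, exactly over F_11. *)
Definition ok (z : pred R) (q c : seq nat) (p v : vec) :=
  [&& z (cone v), ~~ [&& z v.1.1, z v.1.2 & z v.2],
      z (cub (nats c) v - cub (nats c) p)
    & z (quad (nats q) v - quad (nats q) p)].

Definition fixes z q c M := all (fun p => ok z q c p (mapp M p)) cpts.

End TernaryForms.

(** * Transport along ring morphisms *)

Section Morphism.

Local Open Scope ring_scope.

Variables (R S : comNzRingType) (f : {rmorphism R -> S}).

Definition vmap (v : vec R) : vec S := let: (y, z, w) := v in (f y, f z, f w).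
Definition mmap (M : mat R) : mat S :=
  let: (m1, m2, m3) := M in (vmap m1, vmap m2, vmap m3).

Lemma nth_map_rmorph (k : seq R) i : (map f k)`_i = f k`_i.
Proof. by elim: k i => [|a k IHk] [|i] //=; rewrite rmorph0. Qed.

Lemma rmorph_quad k v : f (quad k v) = quad (map f k) (vmap v).
Proof.
case: v => [[y z] w]; rewrite /= !nth_map_rmorph.
by rewrite !(rmorphD, rmorphM, rmorphXn).
Qed.

Lemma rmorph_cub k v : f (cub k v) = cub (map f k) (vmap v).
Proof.
case: v => [[y z] w]; rewrite /= !nth_map_rmorph.
by rewrite !(rmorphD, rmorphM, rmorphXn).
Qed.

Lemma map_nats s : map f (nats R s) = nats S s.
Proof. by rewrite -map_comp; apply: eq_map => n /=; rewrite rmorph_nat. Qed.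

Lemma rmorph_cone v : f (cone v) = cone (vmap v).
Proof. by rewrite !cone_quad rmorph_quad map_nats. Qed.

Lemma rmorph_cform q c x v : f (cform q c x v) = cform q c (f x) (vmap v).
Proof.
by rewrite /cform !rmorphD rmorphM rmorphXn rmorph_quad rmorph_cub !map_nats.
Qed.

Lemma vmap_vlin a v1 b v2 d v3 :
  vmap (vlin a v1 b v2 d v3) = vlin (f a) (vmap v1) (f b) (vmap v2) (f d) (vmap v3).
Proof.
case: v1 v2 v3 => [[y1 z1] w1] [[y2 z2] w2] [[y3 z3] w3] /=.
by rewrite !rmorphD !rmorphM.
Qed.

Lemma map_quad_comp k M : map f (quad_comp k M) = quad_comp (map f k) (mmap M).
Proof.
case: M => [[m1 m2] m3].
by rewrite /= /qpolar !rmorphB !rmorph_quad /vadd !vmap_vlin rmorph0 rmorph1.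
Qed.

Lemma rmorph_cderiv k v1 v2 :
  f (cderiv k v1 v2) = cderiv (map f k) (vmap v1) (vmap v2).
Proof.
case: v1 v2 => [[y z] w] [[y' z'] w']; rewrite /= !nth_map_rmorph.
by rewrite !(rmorphD, rmorphM, rmorphXn, rmorph_nat).
Qed.

Lemma map_cub_comp k M : map f (cub_comp k M) = cub_comp (map f k) (mmap M).
Proof.
case: M => [[m1 m2] m3]; rewrite /= !rmorphB !rmorph_cub !rmorph_cderiv.
by rewrite /vadd vmap_vlin rmorph0 rmorph1.
Qed.

Lemma map_csub n k1 k2 : map f (csub n k1 k2) = csub n (map f k1) (map f k2).
Proof.
by rewrite -map_comp; apply: eq_map => i; rewrite /= rmorphB !nth_map_rmorph.
Qed.

Lemma vmap_mapp M v : vmap (mapp M v) = mapp (mmap M) (vmap v).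
Proof. by case: M v => [[m1 m2] m3] [[y z] w]; rewrite /mapp vmap_vlin. Qed.

Lemma mmap_mmul M N : mmap (mmul M N) = mmul (mmap M) (mmap N).
Proof. by case: N => [[n1 n2] n3]; rewrite /= !vmap_mapp. Qed.

Lemma mmap_mid : mmap (mid R) = mid S.
Proof. by rewrite /= !rmorph0 !rmorph1. Qed.

Lemma map_cpts : map vmap (cpts R) = cpts S.
Proof.
rewrite map_rcons -map_comp; congr rcons; last by rewrite /= rmorph0 rmorph1.
by apply: eq_map => s /=; rewrite rmorphM rmorphXn !rmorph_nat rmorph1.
Qed.

Lemma ok_vmap (zR : pred R) (zS : pred S) q c p v :
  (forall a, zS (f a) = zR a) -> ok zS q c (vmap p) (vmap v) = ok zR q c p v.
Proof.
move=> zf; rewrite /ok -rmorph_cone -!map_nats -!rmorph_cub -!rmorph_quad.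
by rewrite -!rmorphB !zf; case: v => [[y z] w] /=; rewrite !zf.
Qed.

(** Allows the test to be run on integer matrices, once [zR] is divisibility by 11. *)
Lemma fixes_mmap (zR : pred R) (zS : pred S) q c M :
  (forall a, zS (f a) = zR a) -> fixes zS q c (mmap M) = fixes zR q c M.
Proof.
move=> zf; rewrite /fixes -map_cpts all_map; apply: eq_all => p /=.
by rewrite -vmap_mapp (ok_vmap _ _ _ _ zf).
Qed.

End Morphism.

(** * Vanishing on the conic over F_11 *)

Section ConicPoints.

Local Open Scope ring_scope.

Local Notation K := 'F_11.

Lemma charF11 : 11 = 0 :> K.
Proof. exact: val_inj. Qed.

Lemma natrF11 (s : K) : exists2 n, n \in iota 0 11 & s = n%:R.
Proof.
exists (nat_of_ord s); last by rewrite natr_Zp.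
by rewrite mem_iota; exact: (ltn_ord s).
Qed.

Lemma all_cpts (P : pred (vec K)) : all P (cpts K) ->
  (forall s, P (1, s, 5 * s ^+ 2)) /\ P (0, 0, 1).
Proof.
rewrite /cpts all_rcons => /andP[P1 /allP P2]; split=> // s.
by have [n n11 ->] := natrF11 s; apply: P2; apply/mapP; exists n.
Qed.

Lemma poly_vanish (p : {poly K}) :
  (size p <= 11)%N -> (forall s, p.[s] = 0) -> p = 0.
Proof.
move=> sp p0; apply: (@roots_geq_poly_eq0 _ p (enum K)); last first.
- by rewrite -cardE card_Fp.
- exact: enum_uniq.
by apply/allP => s _; rewrite rootE p0.
Qed.

Lemma Poly_vanish (k : seq K) : (size k <= 11)%N ->
  (forall s, (Poly k).[s] = 0) -> forall i, k`_i = 0.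
Proof.
move=> sk k0 i; rewrite -coef_Poly (poly_vanish _ k0) ?coef0 //.
exact: leq_trans (size_Poly k) sk.
Qed.

(** The values at the affine points are those of a polynomial of degree at most 4 in $s$, with 11
    roots, so its coefficients vanish. The relations obtained say that the form is a multiple of
    $2yw + z^2$. *)
Lemma quad_vanish (k : seq K) : all (fun p => quad k p == 0) (cpts K) ->
  [/\ k`_0 = 0, k`_1 = 0, k`_2 = 2 * k`_3, k`_4 = 0 & k`_5 = 0].
Proof.
case/all_cpts => k0 /eqP k5.
have /Poly_vanish coef0 s :
    (Poly [:: k`_0; k`_1; 5 * k`_2 + k`_3; 5 * k`_4; 25 * k`_5]).[s] = 0.
  rewrite horner_Poly -[RHS](eqP (k0 s)) /=; ring.
have nz5 : 5 != 0 :> K by [].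
split; first exact: (coef0 isT 0%N); first exact: (coef0 isT 1%N).
- have /= H := coef0 isT 2%N.
  (* The multiple of 11 is written out so that [ring] faces an identity valid over the integers. *)
  transitivity (2 * k`_3 - 2 * (5 * k`_2 + k`_3) + 11 * k`_2); first by ring.
  by rewrite H charF11; ring.
- by have /= /eqP := coef0 isT 3%N; rewrite mulf_eq0 (negPf nz5) => /eqP.
- rewrite -[RHS]k5 /=; ring.
Qed.

Lemma cub_vanish (k : seq K) : all (fun p => cub k p == 0) (cpts K) ->
  [/\ k`_0 = 0, k`_1 = 0, k`_2 = 2 * k`_3, k`_4 = 2 * k`_6 &
    [/\ k`_5 = 2 * k`_7, k`_8 = 0 & k`_9 = 0]].
Proof.
case/all_cpts => k0 /eqP k9.
have /Poly_vanish coef0 s :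
    (Poly [:: k`_0; k`_1; 5 * k`_2 + k`_3; 5 * k`_4 + k`_6;
              25 * k`_5 + 5 * k`_7; 25 * k`_8; 125 * k`_9]).[s] = 0.
  rewrite horner_Poly -[RHS](eqP (k0 s)) /=; ring.
have nz25 : 25 != 0 :> K by [].
have c11 := charF11.
split; first exact: (coef0 isT 0%N); first exact: (coef0 isT 1%N).
- have /= H := coef0 isT 2%N.
  transitivity (2 * k`_3 - 2 * (5 * k`_2 + k`_3) + 11 * k`_2); first by ring.
  by rewrite H c11; ring.
- have /= H := coef0 isT 3%N.
  transitivity (2 * k`_6 - 2 * (5 * k`_4 + k`_6) + 11 * k`_4); first by ring.
  by rewrite H c11; ring.
split.
- have /= H := coef0 isT 4%N.
  transitivity (2 * k`_7 + 4 * (25 * k`_5 + 5 * k`_7)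
                - 11 * (9 * k`_5 + 2 * k`_7)); first by ring.
  by rewrite H c11; ring.
- by have /= /eqP := coef0 isT 5%N; rewrite mulf_eq0 (negPf nz25) => /eqP.
- rewrite -[RHS]k9 /=; ring.
Qed.

Variables (A : comNzRingType) (f : {rmorphism K -> A}).

Lemma quad_cone (k : seq K) v : all (fun p => quad k p == 0) (cpts K) ->
  quad (map f k) v = f k`_3 * cone v.
Proof.
case/quad_vanish => k0 k1 k2 k4 k5; case: v => [[y z] w].
rewrite /= !nth_map_rmorph k0 k1 k2 k4 k5 rmorph0 rmorphM rmorph_nat; ring.
Qed.

Lemma cub_cone (k : seq K) v : all (fun p => cub k p == 0) (cpts K) ->
  cub (map f k) v = (f k`_3 * v.1.1 + f k`_6 * v.1.2 + f k`_7 * v.2) * cone v.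
Proof.
case/cub_vanish => k0 k1 k2 k4 [k5 k8 k9]; case: v => [[y z] w].
rewrite /= !nth_map_rmorph k0 k1 k2 k4 k5 k8 k9 rmorph0 !rmorphM rmorph_nat; ring.
Qed.

End ConicPoints.

(** * The stabilizer of a curve *)

Section Stabilizer.

Local Open Scope ring_scope.

Local Notation K := 'F_11.
Local Notation form := {mpoly K[4]}.
Local Notation i0 := (@Ordinal 4 0 isT).
Local Notation i1 := (@Ordinal 4 1 isT).
Local Notation i2 := (@Ordinal 4 2 isT).
Local Notation i3 := (@Ordinal 4 3 isT).

Lemma ord4_ind (P : 'I_4 -> Prop) : P i0 -> P i1 -> P i2 -> P i3 -> forall i, P i.
Proof.
move=> P0 P1 P2 P3 [[|[|[|[|//]]]] lti];
  by rewrite (bool_irrelevance lti isT).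
Qed.

Lemma sum4 (V : nmodType) (F : 'I_4 -> V) :
  \sum_i F i = F i0 + F i1 + F i2 + F i3.
Proof.
rewrite !big_ord_recl big_ord0 addr0 !addrA.
by congr (F _ + F _ + F _ + F _); apply: val_inj.
Qed.

Definition vX : vec form := ('X_i1, 'X_i2, 'X_i3).

Definition cubic q c : form := cform q c 'X_i0 vX.

Lemma Q_DegeE : Q_Dege = cone vX.
Proof. by []. Qed.

Definition tailv (u : 'cV[K]_4) : vec K := (u i1 0, u i2 0, u i3 0).

Lemma meval_actp (g : {'GL_4[K]}) (u : 'cV[K]_4) (p : form) :
  (actp g p).@[fun i => u i 0] = p.@[fun i => (GLval g *m u) i 0].
Proof.
rewrite comp_mpoly_meval; apply: meval_eq => i.
rewrite tnth_mktuple raddf_sum mxE; apply: eq_bigr => j _ /=.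
by rewrite mevalZ mevalXU.
Qed.

Lemma meval_cone (u : 'cV[K]_4) : Q_Dege.@[fun i => u i 0] = cone (tailv u).
Proof. by rewrite Q_DegeE rmorph_cone /= !mevalXU. Qed.

Lemma meval_cubic q c (u : 'cV[K]_4) :
  (cubic q c).@[fun i => u i 0] = cform q c (u i0 0) (tailv u).
Proof. by rewrite rmorph_cform /= !mevalXU. Qed.

Lemma qformZ a (M : 'M[K]_4) : qform (a *: M) = a *: qform M.
Proof.
rewrite /qform scaler_sumr; apply: eq_bigr => i _; rewrite scaler_sumr.
by apply: eq_bigr => j _; rewrite mxE scalerA.
Qed.

Lemma actp_Q_Dege (g : {'GL_4[K]}) mu :
  (GLval g)^T *m coef_mx Q_Dege *m GLval g = mu *: coef_mx Q_Dege ->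
  actp g Q_Dege = mu *: Q_Dege.
Proof.
move=> gQ; rewrite [in LHS]Q_Dege_qform actp_qform gQ [in RHS]Q_Dege_qform.
exact: qformZ.
Qed.

(** Polarization: the values at $e_i + e_j$ determine the entries because 4 and 2 are invertible. It
    turns an identity between quadratic forms back into the matrix condition of [stabilizes]. *)
Lemma qform_inj (S T : 'M[K]_4) : S^T = S -> T^T = T -> qform S = qform T -> S = T.
Proof.
move=> symS symT eqST.
pose h (M : 'M[K]_4) (u : 'I_4 -> K) := \sum_i \sum_j M i j * (u i * u j).
have hE M u : (qform M).@[u] = h M u.
  rewrite raddf_sum; apply: eq_bigr => i _ /=.
  rewrite raddf_sum; apply: eq_bigr => j _ /=.
  by rewrite mevalZ mevalM !mevalXU.
have eqh u : h S u = h T u by rewrite -!hE eqST.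
have delta_sum (G : 'I_4 -> K) i : \sum_j G j * (j == i)%:R = G i.
  rewrite (bigD1 i) //= eqxx mulr1 big1 ?addr0 // => j /negPf->.
  by rewrite mulr0.
have hD M i j : M^T = M ->
    h M (fun l => (l == i)%:R + (l == j)%:R) = M i i + M j j + 2 * M i j.
  move=> symM; rewrite /h.
  transitivity (\sum_k ((M k i + M k j) * (k == i)%:R +
                        (M k i + M k j) * (k == j)%:R)).
    apply: eq_bigr => k _; rewrite -mulrDr -[in RHS](delta_sum (M k) i).
    rewrite -[in RHS](delta_sum (M k) j) -big_split mulr_suml.
    by apply: eq_bigr => l _; rewrite /= -mulrDr -mulrA [X in _ * X]mulrC.
  have Mji : M j i = M i j by rewrite -{1}symM mxE.
  by rewrite big_split /= !(delta_sum (fun k => M k i + M k j)) Mji; ring.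
have diag i : S i i = T i i.
  have := eqh (fun l => (l == i)%:R + (l == i)%:R); rewrite !hD //.
  have nz4 : 4 != 0 :> K by [].
  by move=> H; apply: (mulfI nz4); transitivity (S i i + S i i + 2 * S i i);
    [ring | rewrite H; ring].
apply/matrixP => i j.
have := eqh (fun l => (l == i)%:R + (l == j)%:R); rewrite !hD // !diag.
by move/addrI/(mulfI (isT : 2 != 0 :> K)).
Qed.

Lemma coef_mx_sym (p : form) : (coef_mx p)^T = coef_mx p.
Proof. by apply/matrixP => i j; rewrite !mxE addmC eq_sym. Qed.

Lemma coef_mx_Q_neq0 : coef_mx Q_Dege != 0.
Proof.
apply: contraT; rewrite negbK => /eqP Q0.
(* $Q$ takes the value 1 at $(0,0,1,0)$. *)
have := meval_cone (\col_i (i == i2)%:R).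
rewrite Q_Dege_qform Q0 /= !mxE /qform big1 ?meval0 => [|i _]; last first.
  by rewrite big1 // => j _; rewrite mxE scale0r.
by move/eqP.
Qed.

Definition mx4 (M : mat K) : 'M[K]_4 :=
  let: ((a, b, c), (d, e, f), (g, h, i)) := M in
  \matrix_(r, s) (nth [::] [:: [:: 1; 0; 0; 0]; [:: 0; a; d; g];
                              [:: 0; b; e; h]; [:: 0; c; f; i]] r)`_s.

Definition cvec t (v : vec K) : 'cV[K]_4 :=
  \col_r [:: t; v.1.1; v.1.2; v.2]`_r.

Lemma tailv_cvec t v : tailv (cvec t v) = v.
Proof. by case: v => [[y z] w]; rewrite /tailv !mxE. Qed.

Lemma mx4_inj : injective mx4.
Proof.
move=> [[[[a b] c] [[d e] f]] [[g h] i]] [[[[a' b'] c'] [[d' e'] f']] [[g' h'] i']].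
move/matrixP=> E; move: (E i1 i1) (E i1 i2) (E i1 i3) (E i2 i1) (E i2 i2)
  (E i2 i3) (E i3 i1) (E i3 i2) (E i3 i3).
by rewrite !mxE /= => -> -> -> -> -> -> -> -> ->.
Qed.

Lemma mx4_mmul M N : mx4 (mmul M N) = mx4 M *m mx4 N.
Proof.
case: M N => [[[[a b] c] [[d e] f]] [[g h] i]]
  [[[[a' b'] c'] [[d' e'] f']] [[g' h'] i']].
apply/matrixP; elim/ord4_ind; elim/ord4_ind; rewrite !mxE sum4 !mxE /=; ring.
Qed.

Lemma mx4_mid : mx4 (mid K) = 1%:M.
Proof. by apply/matrixP; elim/ord4_ind; elim/ord4_ind; rewrite !mxE. Qed.

Lemma cpts_cone : all (fun p => cone p == 0) (cpts K).
Proof.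
rewrite /cpts all_rcons all_map; apply/andP; split.
  by rewrite /=; apply/eqP; ring.
apply/allP => s _ /=; apply/eqP.
by transitivity (11 * s%:R ^+ 2 : K); [ring | rewrite charF11 mul0r].
Qed.

Local Notation isz := (fun a : K => a == 0).

Local Notation C := (@mpolyC 4 K).

Lemma actp_X (g : {'GL_4[K]}) M : GLval g = mx4 M ->
  actp g 'X_i0 = 'X_i0 /\
  (actp g 'X_i1, actp g 'X_i2, actp g 'X_i3) = mapp (mmap C M) vX.
Proof.
move=> gM; case: M gM => [[[[a b] c] [[d e] f]] [[m h] i]] gM.
have actX (j : 'I_4) : actp g 'X_j = \sum_k (GLval g j k)%:MP * 'X_k.
  rewrite /actp comp_mpolyXU -tnth_nth tnth_mktuple.
  by apply: eq_bigr => k _; rewrite mul_mpolyC.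
rewrite !actX !sum4 gM !mxE /= !mpolyC0 !mpolyC1.
split; first by ring.
by congr (_, _, _); ring.
Qed.

Lemma actp_cone (g : {'GL_4[K]}) M : GLval g = mx4 M ->
  actp g Q_Dege = cone (mapp (mmap C M) vX).
Proof. by case/actp_X=> _ <-; rewrite /actp Q_DegeE rmorph_cone. Qed.

Lemma actp_cubic q c (g : {'GL_4[K]}) M : GLval g = mx4 M ->
  actp g (cubic q c) = cform q c 'X_i0 (mapp (mmap C M) vX).
Proof.
by case/actp_X=> X0 <-; rewrite -[X in cform _ _ X _]X0 /actp rmorph_cform.
Qed.

(** The differences between $q$, $c$ and their composites with $M$ vanish on the conic points, hence
    are divisible by $Q$ as polynomials; so is $Q \circ M$. *)
Lemma stab_mx4 q c (g : {'GL_4[K]}) M : GLval g = mx4 M -> fixes isz q c M ->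
  g \in stab_GL Q_Dege (cubic q c).
Proof.
move=> gM /allP fixM; apply/stab_GLP; split.
  pose k := quad_comp (nats K [:: 0; 0; 2; 1]%N) M.
  have k0 : all (fun p => quad k p == 0) (cpts K).
    apply/allP => p /fixM /and4P[Mp _ _ _].
    by rewrite /k -quad_mapp -cone_quad.
  have gQ : actp g Q_Dege = k`_3 *: Q_Dege.
    rewrite (actp_cone gM) cone_quad quad_mapp -(map_nats C) -map_quad_comp.
    by rewrite (quad_cone C _ k0) -Q_DegeE mul_mpolyC.
  have gQmx : (GLval g)^T *m coef_mx Q_Dege *m GLval g = k`_3 *: coef_mx Q_Dege.
    apply: qform_inj; rewrite ?linearZ /= ?coef_mx_sym //.
      by rewrite !trmx_mul trmxK coef_mx_sym mulmxA.
    by rewrite -actp_qform -Q_Dege_qform gQ qformZ -Q_Dege_qform.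
  (* The multiplier is the coefficient of $z^2$ in $Q \circ M$. If it were 0, cancelling the
     invertible [g] on both sides would make the matrix of $Q$ vanish. *)
  exists k`_3; split=> //; apply: contraNneq coef_mx_Q_neq0 => k30.
  have Ug : GLval g \in unitmx by exact: (valP g).
  have UgT : (GLval g)^T \in unitmx by rewrite unitmx_tr.
  apply/eqP; move: gQmx; rewrite k30 scale0r.
  move/(congr1 (fun X => X *m invmx (GLval g))); rewrite mulmxK // mul0mx.
  by move/(congr1 (mulmx (invmx (GLval g)^T))); rewrite mulKmx // mulmx0.
exists 1; split; first exact: oner_neq0.
pose kq := csub 6 (quad_comp (nats K q) M) (nats K q).
pose kc := csub 10 (cub_comp (nats K c) M) (nats K c).
have kq0 : all (fun p => quad kq p == 0) (cpts K).
  apply/allP => p /fixM /and4P[_ _ _ Mp].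
  by rewrite /kq quad_csub -quad_mapp.
have kc0 : all (fun p => cub kc p == 0) (cpts K).
  apply/allP => p /fixM /and4P[_ _ Mp _].
  by rewrite /kc cub_csub -cub_mapp.
have eqq : quad (map C kq) vX =
    quad (nats form q) (mapp (mmap C M) vX) - quad (nats form q) vX.
  by rewrite quad_mapp -(map_nats C) -map_quad_comp -quad_csub -map_csub.
have eqc : cub (map C kc) vX =
    cub (nats form c) (mapp (mmap C M) vX) - cub (nats form c) vX.
  by rewrite cub_mapp -(map_nats C) -map_cub_comp -cub_csub -map_csub.
rewrite scale1r (actp_cubic _ _ gM) /cubic /cform.
rewrite (quad_cone C vX kq0) -Q_DegeE in eqq.
rewrite (cub_cone C vX kc0) -Q_DegeE in eqc.
set lc := (X in X * _ = _) in eqc; set lq := (X in X * _ = _) in eqq.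
exists ('X_i0 * lq + lc); rewrite mulrDl eqc -mulrA eqq; ring.
Qed.

Local Notation o3 := ((0, 0, 0) : vec K).

(** Only values at F_11-points are retained; [stab_block] recovers the shape of [g] from them. *)
Lemma stab_evals q c (g : {'GL_4[K]}) : g \in stab_GL Q_Dege (cubic q c) ->
  exists mu r : K,
   (forall u, cone (tailv (GLval g *m u)) = mu * cone (tailv u)) /\
   (forall u, cone (tailv u) = 0 ->
     cform q c ((GLval g *m u) i0 0) (tailv (GLval g *m u)) =
     r * cform q c (u i0 0) (tailv u)).
Proof.
case/stab_GLP=> -[mu [_ gQ]] [r [_ [R gP]]]; exists mu, r; split=> u.
  by rewrite -!meval_cone -meval_actp (actp_Q_Dege gQ) mevalZ.
move=> u0; rewrite -!meval_cubic -meval_actp; apply/eqP.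
by rewrite -mevalZ -subr_eq0 -mevalB gP mevalM meval_cone u0 mulr0.
Qed.

(** Translation along $e_x$ leaves $Q$ unchanged, hence so does translation along $m e_x$: that
    vector lies in the radical of $Q$, which is the x-axis. *)
Lemma cone_col0 (m : 'M[K]_4) mu : m \in unitmx ->
  (forall u, cone (tailv (m *m u)) = mu * cone (tailv u)) ->
  [/\ m i1 i0 = 0, m i2 i0 = 0 & m i3 i0 = 0].
Proof.
move=> Um mQ; pose c := m *m cvec 1 o3.
have cE i : c i 0 = m i i0 by rewrite mxE sum4 !mxE /=; ring.
have shift t v : cone (tailv (cvec t v + c)) = cone v.
  have -> : cvec t v + c = m *m (invmx m *m cvec t v + cvec 1 o3).
    by rewrite mulmxDr mulKVmx.
  rewrite mQ; have -> : cone v = cone (tailv (m *m (invmx m *m cvec t v))).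
    by rewrite mulKVmx // tailv_cvec.
  by rewrite mQ /tailv !mxE /= !addr0.
clearbody c.
(* Subtracting the first value from the others isolates the polar pairings of the column with the
   basis vectors: $2w$, $2y$ and $2z$. *)
move: (shift 0 o3) (shift 0 (1, 0, 0)) (shift 0 (0, 0, 1)) (shift 0 (0, 1, 0)).
rewrite /tailv !mxE /= !cE.
set y := m i1 i0; set z := m i2 i0; set w := m i3 i0 => H0 H1 H2 H3.
have nz2 : 2 != 0 :> K by [].
split; apply: (mulfI nz2); rewrite mulr0.
- transitivity (2 * (0 + y) * (1 + w) + (0 + z) ^+ 2
                - (2 * (0 + y) * (0 + w) + (0 + z) ^+ 2)); first by ring.
  by rewrite H2 H0; ring.
- transitivity (2 * (0 + y) * (0 + w) + (1 + z) ^+ 2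
                - (2 * (0 + y) * (0 + w) + (0 + z) ^+ 2) - 1); first by ring.
  by rewrite H3 H0; ring.
- transitivity (2 * (1 + y) * (0 + w) + (0 + z) ^+ 2
                - (2 * (0 + y) * (0 + w) + (0 + z) ^+ 2)); first by ring.
  by rewrite H1 H0; ring.
Qed.

Definition block3 (m : 'M[K]_4) : mat K :=
  ((m i1 i1, m i2 i1, m i3 i1), (m i1 i2, m i2 i2, m i3 i2),
   (m i1 i3, m i2 i3, m i3 i3)).

(* The vanishing of the shear in x is read off the second difference in t at    *)
(* the points (t, p), p on the conic.                                           *)
Lemma stab_block q c (m : 'M[K]_4) mu r : m \in unitmx -> m i0 i0 = 1 ->
  (forall u, cone (tailv (m *m u)) = mu * cone (tailv u)) ->
  (forall u, cone (tailv u) = 0 ->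
     cform q c ((m *m u) i0 0) (tailv (m *m u)) =
     r * cform q c (u i0 0) (tailv u)) ->
  m = mx4 (block3 m) /\ fixes isz q c (block3 m).
Proof.
move=> Um m00 mQ mP; have [m10 m20 m30] := cone_col0 Um mQ.
pose l (p : vec K) := m i0 i1 * p.1.1 + m i0 i2 * p.1.2 + m i0 i3 * p.2.
have mE t p : m *m cvec t p = cvec (t + l p) (mapp (block3 m) p).
  case: p => [[y z] w]; apply/colP; elim/ord4_ind;
    by rewrite mxE sum4 !mxE /= ?m00 ?m10 ?m20 ?m30 /l /=; ring.
have mP' t p : cone p = 0 ->
    cform q c (t + l p) (mapp (block3 m) p) = r * cform q c t p.
  move=> p0; have := mP (cvec t p); rewrite mE !tailv_cvec => /(_ p0).
  by rewrite !mxE.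
(* At the vertex the form reduces to $x^3$, and the corner entry is 1. *)
have r1 : r = 1.
  have L1 : cform q c (1 + l o3) (mapp (block3 m) o3) = 1.
    by rewrite /cform /l /=; ring.
  have R1 : cform q c 1 o3 = 1 by rewrite /cform /=; ring.
  by rewrite -L1 mP' ?R1 ?mulr1 //=; ring.
have {}mP' p : cone p = 0 -> [/\ l p = 0,
    cub (nats K c) (mapp (block3 m) p) = cub (nats K c) p
    & quad (nats K q) (mapp (block3 m) p) = quad (nats K q) p].
  move=> p0; move: (mP' 0 p p0) (mP' 1 p p0) (mP' (-1) p p0).
  rewrite r1 /cform; set C' := cub _ (mapp _ _); set Q' := quad _ (mapp _ _).
  move=> H0 H1 H2.
  (* $(l+1)^3 + (l-1)^3 - 2l^3 = 6l$, while the same second difference of $r(t^3 + tq + c)$ is 0. *)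
  have nz6 : 6 != 0 :> K by [].
  have lp0 : l p = 0.
    apply: (mulfI nz6); rewrite mulr0; move: H0 H1 H2.
    set E0 := (X in X = _ -> _) => H0; set E1 := (X in X = _ -> _) => H1.
    set E2 := (X in X = _ -> _) => H2.
    transitivity (E1 + E2 - 2 * E0); first by rewrite /E0 /E1 /E2; ring.
    by rewrite H0 H1 H2; ring.
  rewrite lp0 in H0 H1.
  have eqC : C' = cub (nats K c) p.
    transitivity ((0 + 0) ^+ 3 + (0 + 0) * Q' + C'); first by ring.
    by rewrite H0; ring.
  split=> //; rewrite eqC in H1.
  transitivity ((1 + 0) ^+ 3 + (1 + 0) * Q' + cub (nats K c) p
                - 1 - cub (nats K c) p); first by ring.
  by rewrite H1; ring.
have cone0 p : p \in cpts K -> cone p = 0 by move/(allP cpts_cone)/eqP.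
have cone1 (s : K) : cone (1, s, 5 * s ^+ 2) = 0.
  by transitivity (11 * s ^+ 2); [rewrite /=; ring | rewrite charF11 mul0r].
(* The points $(1,0,0)$, $(1,1,5)$ and $(0,0,1)$ form a basis, so [l] vanishes identically. *)
have [l1 _ _] := mP' _ (cone1 0); have [l2 _ _] := mP' _ (cone1 1).
have [|l3 _ _] := mP' (0, 0, 1); first by rewrite /=; ring.
have m01 : m i0 i1 = 0 by rewrite -[RHS]l1 /l /=; ring.
have m03 : m i0 i3 = 0 by rewrite -[RHS]l3 /l /=; ring.
have m02 : m i0 i2 = 0 by rewrite -[RHS]l2 /l /= m01 m03; ring.
split.
  by apply/matrixP; elim/ord4_ind; elim/ord4_ind; rewrite !mxE.
apply/allP => p p_in; have p0 := cone0 p p_in.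
have [lp0 eqC eqQ] := mP' p p0.
apply/and4P; split; last 2 first.
- by rewrite eqC subrr.
- by rewrite eqQ subrr.
- have := mQ (cvec 0 p); rewrite mE !tailv_cvec p0 mulr0 => ->; exact: eqxx.
apply/negP => /and3P[/eqP p1 /eqP p2 /eqP p3].
have mp : m *m cvec 0 p = 0.
  by rewrite mE lp0; apply/colP; elim/ord4_ind; rewrite !mxE /= ?addr0.
have /(congr1 (mulmx (invmx m))) := mp; rewrite mulKmx // mulmx0.
case: p p_in {p0 lp0 eqC eqQ p1 p2 p3 mp} => [[y z] w] p_in /colP p0.
move: (p0 i1) (p0 i3); rewrite !mxE /= => y0 w0.
(* Every listed point has $y = 1$ or $w = 1$, so none is the zero vector. *)
move: p_in; rewrite y0 w0 mem_rcons inE => /orP[|/mapP[s _] []].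
  by case/eqP=> _ /esym/eqP.
by move=> /esym/eqP.
Qed.

(** The corner entry is nonzero, the rest of its column being 0; dividing by it reduces to
    [stab_block]. *)
Lemma stab_normal q c (g : {'GL_4[K]}) : g \in stab_GL Q_Dege (cubic q c) ->
  exists a M, [/\ a != 0, GLval g = a *: mx4 M & fixes isz q c M].
Proof.
case/stab_evals=> mu [r [gQ gP]]; set m := GLval g in gQ gP *.
have Um : m \in unitmx by exact: (valP g).
have [m10 m20 m30] := cone_col0 Um gQ.
have a0 : m i0 i0 != 0.
  apply: contraTneq Um => m00; apply/negP => Um.
  have : m *m cvec 1 o3 = 0.
    apply/colP; elim/ord4_ind; rewrite mxE sum4 !mxE /= ?m00 ?m10 ?m20 ?m30; ring.
  move/(congr1 (mulmx (invmx m))); rewrite mulKmx // mulmx0.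
  by move/colP/(_ i0); rewrite !mxE /= => /eqP.
set a := m i0 i0 in a0; pose b := a^-1; have ab : b * a = 1 by rewrite mulVf.
have Ubm : b *: m \in unitmx by rewrite unitmxZ // unitfE invr_eq0.
have tailZ (u : 'cV[K]_4) :
    tailv (b *: u) = (b * u i1 0, b * u i2 0, b * u i3 0).
  by rewrite /tailv !mxE.
have coneZ (u : 'cV[K]_4) : cone (tailv (b *: u)) = b ^+ 2 * cone (tailv u).
  by rewrite tailZ /=; ring.
have cformZ (u : 'cV[K]_4) : cform q c ((b *: u) i0 0) (tailv (b *: u)) =
    b ^+ 3 * cform q c (u i0 0) (tailv u).
  by rewrite tailZ mxE /cform /=; ring.
have [|u|u u0|eqm fixm] := @stab_block q c (b *: m) (b ^+ 2 * mu) (b ^+ 3 * r) Ubm.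
- by rewrite mxE.
- by rewrite -scalemxAl coneZ gQ mulrA.
- by rewrite -scalemxAl cformZ gP // mulrA.
exists a, (block3 (b *: m)); split=> //.
by rewrite -eqm scalerA mulfV // scale1r.
Qed.

End Stabilizer.

(** * Enumeration modulo 11 *)

Section Enumeration.

Local Open Scope ring_scope.

Local Notation K := 'F_11.
Local Notation isz := (fun a : K => a == 0).

Definition red (a : Z) : K := (int_of_Z a)%:~R.

HB.instance Definition _ := GRing.RMorphism.copy red (intmul 1 \o int_of_Z).

Definition zp11 (a : Z) := Z.eqb (Z.modulo a (Z.of_nat 11)) Z0.

Lemma red_eq0 a : (red a == 0) = zp11 a.
Proof.
rewrite /zp11 {1}(Z_div_mod_eq_full a (Z.of_nat 11)).
have -> (q r : Z) : red (Z.of_nat 11 * q + r)%Z = red r.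
  change (red (Z.of_nat 11 * q + r : Z) = red r).
  by rewrite rmorphD rmorphM /= [red (Z.of_nat 11)]charF11 mul0r add0r.
have [] := Z.mod_pos_bound a (Z.of_nat 11) erefl.
move: (Z.modulo a (Z.of_nat 11)) => r.
case: r => [|r|r] // _ r11.
have [n -> n11] : exists2 n, Z.pos r = Z.of_nat n & (n < 11)%N.
  by exists (Pos.to_nat r); lia.
by do 11![case: n n11 => [|n] n11; first by []].
Qed.

Lemma fixes_red q c (M : mat Z) : fixes isz q c (mmap red M) = fixes zp11 q c M.
Proof. exact: (@fixes_mmap _ _ red _ isz _ _ _ red_eq0). Qed.

Definition residues : seq Z := [seq Z.of_nat n | n <- iota 0 11].

Lemma residuesP (a : K) : exists2 b, b \in residues & red b = a.
Proof.
have [n n11 ->] := natrF11 a; exists (Z.of_nat n); first exact: map_f.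
by rewrite -(rmorph_nat red) -(rmorph_nat Z.of_nat) natn.
Qed.

(** Vectors rather than projective points: the values of $q$ and $c$ change under scaling. *)
Definition cone_residues : seq (vec Z) :=
  [seq v <- [seq (t, w) | t <- [seq (y, z) | y <- residues, z <- residues],
                          w <- residues] | zp11 (cone v)].

Definition conic_images q c p := [seq v <- cone_residues | ok zp11 q c p v].

(* The columns are recovered from the images of (1, 0, 0), (1, 1, 5), (0, 0, 1). *)
Definition mat_of_images (u1 u2 u3 : vec Z) : mat Z :=
  (u1, vlin 1 u2 (-1) u1 (- 5) u3, u3).

Definition autos q c : seq (mat Z) :=
  [seq M <- [seq mat_of_images t.1 t.2 u |
              t <- [seq (u1, u2) | u1 <- conic_images q c (1, 0, 0),
                                   u2 <- conic_images q c (1, 1, 5)],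
              u <- conic_images q c (0, 0, 1)]
   | fixes zp11 q c M].

Lemma conic_imagesP q c (M : mat K) p : fixes isz q c M -> p \in cpts Z ->
  exists2 u, u \in conic_images q c p & vmap red u = mapp M (vmap red p).
Proof.
move=> /allP fixM p_in.
have okp : ok isz q c (vmap red p) (mapp M (vmap red p)).
  by apply: fixM; rewrite -(map_cpts red) map_f.
move: okp; case: (mapp M (vmap red p)) => [[y z] w].
have [y' y'r <-] := residuesP y; have [z' z'r <-] := residuesP z.
have [w' w'r <-] := residuesP w; rewrite -[(_, _, _)]/(vmap red (y', z', w')).
rewrite (ok_vmap _ _ _ _ red_eq0) => okp; exists (y', z', w') => //.
rewrite mem_filter okp mem_filter; have /and4P[-> _ _ _] := okp.
by apply: (allpairs_f pair) => //; apply: allpairs_f.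
Qed.

(** Completeness of the search: the images of the three chosen points lie in the filtered lists and
    determine [M]. *)
Lemma autosP q c (M : mat K) : fixes isz q c M ->
  exists2 N, N \in autos q c & mmap red N = M.
Proof.
move=> fixM.
have [|u1 u1_in E1] := conic_imagesP (p := (1, 0, 0)) fixM; first by [].
have [|u2 u2_in E2] := conic_imagesP (p := (1, 1, 5)) fixM; first by [].
have [|u3 u3_in E3] := conic_imagesP (p := (0, 0, 1)) fixM; first by [].
have defM : mmap red (mat_of_images u1 u2 u3) = M.
  rewrite /mmap /mat_of_images vmap_vlin E1 E2 E3 /= !rmorphN !rmorph_nat.
  rewrite !rmorph0 !rmorph1; case: (M) => [[[[a b] d] [[e f] g]] [[h i] j]] /=.
  by congr (_, _, _, (_, _, _), (_, _, _)); ring.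
exists (mat_of_images u1 u2 u3) => //.
have fixN : fixes zp11 q c (mat_of_images u1 u2 u3).
  by rewrite -fixes_red defM.
rewrite mem_filter fixN; move: u1_in u2_in u3_in {E1 E2 E3}.
move: (conic_images _ _ _) (conic_images _ _ _) (conic_images _ _ _) => s1 s2 s3.
move=> u1_in u2_in u3_in; apply/allpairsP; exists ((u1, u2), u3).
by split=> //; apply: allpairs_f.
Qed.

End Enumeration.

(** * The automorphism groups *)

Section ProjectiveLinear.

Local Open Scope group_scope.

Variable K : finFieldType.
Implicit Types (A B : 'M[K]_4) (g h : {'GL_4[K]}).

Local Notation scal := (scalar_GL K).

(** A singular matrix is sent to the identity by default. *)
Definition mxGL A : {'GL_4[K]} := insubd (1 : {'GL_4[K]}) A.

Lemma mxGLK A : A \in unitmx -> GLval (mxGL A) = A.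
Proof. by move=> UA; apply: insubdK. Qed.

Definition mxPGL A : coset_of scal := coset scal (mxGL A).

Lemma norm_scalar g : g \in 'N(scal).
Proof. exact: (subsetP (normal_norm (scalar_GL_normal K)) g (in_setT g)). Qed.

Lemma coset_scalarP g h :
  (coset scal g = coset scal h) <-> (exists a, GLval g = a *: GLval h)%R.
Proof.
have Uh : GLval h \in unitmx by exact: (valP h).
split=> [/(rcoset_kercosetP (norm_scalar g) (norm_scalar h))|[a gh]].
  rewrite mem_rcoset => /scalar_GLP[a gha]; exists a.
  transitivity (GLval (g * h^-1 * h)); first by rewrite mulgKV.
  by rewrite GL_MxE gha; apply: mul_scalar_mx.
apply/(rcoset_kercosetP (norm_scalar g) (norm_scalar h)).
rewrite mem_rcoset; apply/scalar_GLP; exists a.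
by rewrite GL_MxE GL_VxE gh -scalemxAl mulmxV // scalemx1.
Qed.

Lemma coset_mxPGL g B : B \in unitmx ->
  (coset scal g = mxPGL B) <-> (exists a, GLval g = a *: B)%R.
Proof. by move=> UB; rewrite -{2}(mxGLK UB); apply: coset_scalarP. Qed.

Lemma mxPGL_eq A B : A \in unitmx -> B \in unitmx ->
  (mxPGL A = mxPGL B) <-> (exists a, A = a *: B)%R.
Proof. by move=> UA UB; rewrite -{2}(mxGLK UA); apply: coset_mxPGL. Qed.

Lemma mxPGL1 : mxPGL 1%:M = 1.
Proof.
have E : GLval (mxGL 1%:M) = GLval 1 by rewrite mxGLK ?unitmx1 ?GL_1E.
by rewrite /mxPGL (val_inj E) morph1.
Qed.

Lemma mxPGL_mul A B : A \in unitmx -> B \in unitmx ->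
  mxPGL (A *m B)%R = mxPGL A * mxPGL B.
Proof.
move=> UA UB; have E : GLval (mxGL (A *m B)) = GLval (mxGL A * mxGL B).
  by rewrite GL_MxE !mxGLK // unitmx_mul UA.
by rewrite /mxPGL (val_inj E) morphM ?norm_scalar.
Qed.

Lemma mxPGL_stab (G : {group {'GL_4[K]}}) A :
  mxGL A \in G -> mxPGL A \in (G / scal)%G.
Proof. exact: mem_quotient. Qed.

Lemma quotient_scalarP (G : {set {'GL_4[K]}}) x :
  x \in G / scal -> exists2 g, g \in G & x = coset scal g.
Proof. by case/morphimP=> g _ Gg ->; exists g. Qed.

End ProjectiveLinear.

Lemma card_leq_size (T : finType) (I : eqType) (A : {set T}) (f : I -> T)
    (s : seq I) :
  (forall x, x \in A -> exists2 i, i \in s & x = f i) -> #|A| <= size s.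
Proof.
move=> fA; rewrite -(size_map f); apply: leq_trans (card_size _).
by apply/subset_leq_card/subsetP => x /fA[i si ->]; apply: map_f.
Qed.

(** * Integer matrices as automorphisms *)

Section AutomorphismGroups.

Local Open Scope group_scope.

Local Notation K := 'F_11.
Local Notation scal := (scalar_GL K).
Local Notation Aut q c := (curve_aut Q_Dege (cubic q c)).

Definition rho (M : mat Z) : coset_of scal := mxPGL (mx4 (mmap red M)).

Definition invertible (M : mat Z) := mx4 (mmap red M) \in unitmx.

Definition meq (M N : mat Z) : bool :=
  let: ((a, b, c), (d, e, f), (g, h, i)) := M in
  let: ((a', b', c'), (d', e', f'), (g', h', i')) := N in
  all zp11 [:: a - a'; b - b'; c - c'; d - d'; e - e'; f - f';
               g - g'; h - h'; i - i']%R.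

Lemma meqP M N : reflect (mmap red M = mmap red N) (meq M N).
Proof.
case: M N => [[[[a b] c] [[d e] f]] [[g h] i]]
  [[[[a' b'] c'] [[d' e'] f']] [[g' h'] i']].
rewrite /meq /mmap /vmap /= -!red_eq0 !rmorphB /= !subr_eq0 andbT.
apply: (iffP idP) => [|[-> -> -> -> -> -> -> -> ->]]; last by rewrite !eqxx.
by do 8![case/andP=> /eqP->]; move/eqP->.
Qed.

Lemma rho_eq M N : meq M N -> rho M = rho N.
Proof. by rewrite /rho => /meqP->. Qed.

(** Both 4 by 4 matrices have corner entry 1, so the scalar relating them is 1. *)
Lemma rho_inj M N : invertible M -> invertible N -> rho M = rho N -> meq M N.
Proof.
move=> UM UN /(mxPGL_eq UM UN)[a MN]; apply/meqP.
apply: mx4_inj; rewrite MN; have -> : a = 1%R; last by rewrite scale1r.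
have := congr1 (fun m : 'M[K]_4 => m (@Ordinal 4 0 isT) (@Ordinal 4 0 isT)) MN.
case: (mmap red M) (mmap red N) => [[[[? ?] ?] [[? ?] ?]] [[? ?] ?]]
  [[[[? ?] ?] [[? ?] ?]] [[? ?] ?]].
by rewrite !mxE /= mulr1.
Qed.

Lemma invertible_mid : invertible (mid Z).
Proof. by rewrite /invertible mmap_mid mx4_mid unitmx1. Qed.

Lemma rho_mid : rho (mid Z) = 1.
Proof. by rewrite /rho mmap_mid mx4_mid mxPGL1. Qed.

Lemma rho_mmul M N : invertible M -> invertible N ->
  invertible (mmul M N) /\ rho (mmul M N) = rho M * rho N.
Proof.
move=> UM UN; rewrite /invertible /rho mmap_mmul mx4_mmul unitmx_mul.
split; first exact/andP.
exact: mxPGL_mul.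
Qed.

Lemma rho_mexp M n : invertible M ->
  invertible (mexp M n) /\ rho (mexp M n) = rho M ^+ n.
Proof.
move=> UM; elim: n => [|n [Un IHn]]; first by rewrite rho_mid invertible_mid.
have [U E] := rho_mmul UM Un; split; first exact: U.
by rewrite expgS -IHn -E.
Qed.

Lemma mexpS (R : comNzRingType) (M : mat R) n : mexp M n.+1 = mmul M (mexp M n).
Proof. by []. Qed.

Definition has_order (M : mat Z) n :=
  [&& (0 < n)%N, meq (mexp M n) (mid Z)
    & all (fun i => ~~ meq (mexp M i) (mid Z)) (iota 1 n.-1)].

(** $M^{n-1}$ is an inverse of $M$; by [rho_inj], no smaller power becomes trivial modulo
    scalars. *)
Lemma has_order_rho M n : has_order M n -> invertible M /\ #[rho M] = n.
Proof.
case/and3P=> n_gt0 Mn1 ltMn.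
have UM : invertible M.
  move/meqP: Mn1; rewrite -(prednK n_gt0) mexpS mmap_mmul mmap_mid.
  move/(congr1 mx4); rewrite mx4_mmul mx4_mid.
  by case/mulmx1_unit.
split=> //; have [_ rMn] := rho_mexp n UM.
have rMn1 : rho M ^+ n = 1 by rewrite -rMn (rho_eq Mn1) rho_mid.
have le_n : (#[rho M] <= n)%N by rewrite dvdn_leq // order_dvdn rMn1.
apply/eqP; rewrite eqn_leq le_n leqNgt; apply/negP => lt_n.
have /(allP ltMn) /negP : #[rho M] \in iota 1 n.-1.
  by rewrite mem_iota order_gt0 add1n prednK.
apply; have [U E] := rho_mexp #[rho M] UM.
apply: (rho_inj U invertible_mid).
by rewrite E rho_mid expg_order.
Qed.

Lemma rho_aut q c M : invertible M -> fixes zp11 q c M -> rho M \in Aut q c.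
Proof.
move=> UM fixM; apply: (@mxPGL_stab _ (stab_GL_Dege_group (cubic q c))).
by apply: (stab_mx4 (mxGLK UM)); rewrite fixes_red.
Qed.

Lemma aut_rho q c x : x \in Aut q c -> exists2 M, M \in autos q c & x = rho M.
Proof.
case/quotient_scalarP=> g /stab_normal[a [M [a0 gM fixM]]] ->.
have [N N_in NM] := autosP fixM; exists N; first exact: N_in.
have UM : mx4 M \in unitmx.
  have : GLval g \in unitmx by exact: (valP g).
  by rewrite gM unitmxZ // unitfE.
rewrite /rho NM; apply/coset_mxPGL; first exact: UM.
by exists a.
Qed.

Lemma card_aut q c : (#|Aut q c| <= size (autos q c))%N.
Proof. exact: card_leq_size (@aut_rho q c). Qed.

(** A closed boolean over the integers, decided by evaluation for each concrete curve. *)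
Definition cyclic_cert q c M n :=
  [&& (1 < n)%N, (size (autos q c) <= n)%N, fixes zp11 q c M & has_order M n].

Lemma aut_cyclic q c M n : cyclic_cert q c M n -> Aut q c \isog Zp n.
Proof.
case/and4P=> n_gt1 le_n fixM /has_order_rho[UM oM].
pose A := (stab_GL Q_Dege (cubic q c) / scal)%G.
have A_rho : rho M \in A by exact: rho_aut.
have cycA : Aut q c = <[rho M]>.
  apply/eqP; rewrite -[Aut q c]/(gval A) eq_sym eqEcard cycle_subG A_rho -orderE oM.
  exact: leq_trans (card_aut q c) le_n.
have cycZ : cyclic (Zp n) by rewrite /Zp n_gt1 Zp_cycle cycle_cyclic.
rewrite cycA isog_cyclic_card ?cycle_cyclic // cycZ card_Zp ?(ltnW n_gt1) //.
by rewrite -orderE oM eqxx.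
Qed.

End AutomorphismGroups.

(** * Recognizing dihedral groups *)

Section GroupRecognition.

Local Open Scope group_scope.

(** As [x] lies outside the cyclic group of order [m] generated by [x * y], the two involutions
    generate a group of order at least [2m], which must be all of [G]. *)
Lemma involutions_isog_dihedral (gT : finGroupType) (G : {group gT}) (x y : gT) m :
  (1 < m)%N -> (#|G| <= m.*2)%N -> x \in G -> y \in G -> #[x] = 2 -> #[y] = 2 ->
  #[x * y] = m -> x \notin <[x * y]> -> G \isog 'D_(m.*2).
Proof.
move=> m_gt1 le_2m Gx Gy ox oy oxy x_xy.
have neq_xy : x != y.
  apply: contraNneq x_xy => eq_xy.
  by move: m_gt1; rewrite -oxy -eq_xy -expg2 -{2}ox expg_order order1.
pose H := <<[set x; y]>>.
have sHG : H \subset G by rewrite gen_subG subUset !sub1set Gx.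
have sxyH : <[x * y]> \proper H.
  rewrite properE cycle_subG groupM ?mem_gen ?set21 ?set22 //=.
  by apply: contra x_xy => /subsetP; apply; rewrite mem_gen ?set21.
have le_2mH : (m.*2 <= #|H|)%N.
  have := Lagrange (proper_sub sxyH); rewrite -orderE oxy => <-.
  by rewrite -muln2 leq_mul // indexg_gt1 proper_subn.
have oH : #|H| = m.*2.
  apply/eqP; rewrite eqn_leq le_2mH andbT.
  exact: leq_trans (subset_leq_card sHG) le_2m.
have <- : H = G by apply/eqP; rewrite eqEcard sHG oH.
by rewrite -oH; apply: involutions_gen_dihedral.
Qed.

(** Lets the dihedral certificate with [m = 2] serve for the Klein four-groups. *)
Lemma Klein_dihedral : setX (Zp 2) (Zp 2) \isog 'D_4.
Proof.
pose x : 'Z_2 * 'Z_2 := (Zp1, Zp0); pose y : 'Z_2 * 'Z_2 := (Zp0, Zp1).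
apply: (@involutions_isog_dihedral _ (setX_group _ _) x y 2) => //.
- by rewrite cardsX card_Zp.
- by rewrite in_setX /Zp /= !inE.
- by rewrite in_setX /Zp /= !inE.
- by apply: nt_prime_order => //; apply/eqP.
- by apply: nt_prime_order => //; apply/eqP.
- by apply: nt_prime_order => //; apply/eqP.
have oxy : #[x * y] = 2 by apply: nt_prime_order => //; apply/eqP.
(* Only the exponents 0 and 1 lie below the order 2; they give the identity and [x * y], both
   distinct from [x]. *)
by apply/negP => /cyclePmin[[|[|i]]]; rewrite oxy.
Qed.

End GroupRecognition.

(** * Isomorphism types from certificates *)

Section Isomorphisms.

Local Open Scope group_scope.

Local Notation K := 'F_11.
Local Notation scal := (scalar_GL K).
Local Notation Aut q c := (curve_aut Q_Dege (cubic q c)).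
Local Notation AutG q c := (stab_GL_Dege_group (cubic q c) / scal)%G.

Lemma aut_trivial q c : (size (autos q c) <= 1)%N -> Aut q c \isog [1 'S_1].
Proof.
move=> le1; apply: (@trivial_isog _ _ (AutG q c) [1 'S_1]%G) => //.
by apply/card_le1_trivg/(leq_trans (card_aut q c)).
Qed.

Definition dihedral_cert q c M N m :=
  [&& (1 < m)%N, (size (autos q c) <= m.*2)%N,
      fixes zp11 q c M && has_order M 2, fixes zp11 q c N && has_order N 2,
      has_order (mmul M N) m
    & all (fun i => ~~ meq M (mexp (mmul M N) i)) (iota 0 m)].

Lemma aut_dihedral q c M N m : dihedral_cert q c M N m -> Aut q c \isog 'D_(m.*2).
Proof.
case/and5P=> m_gt1 le_2m /andP[fixM /has_order_rho[UM oM]].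
case/andP=> fixN /has_order_rho[UN oN] /andP[/has_order_rho[UMN oMN] notin].
have [_ rMN] := rho_mmul UM UN.
have le_A := leq_trans (card_aut q c) le_2m.
apply: (involutions_isog_dihedral (G := AutG q c) m_gt1 le_A
          (rho_aut UM fixM) (rho_aut UN fixN) oM oN); first by rewrite -rMN.
rewrite -rMN; apply/negP => /cyclePmin[i]; rewrite oMN => lt_im.
have [U <-] := rho_mexp i UMN => /(rho_inj UM U); apply/negP.
by apply: (allP notin); rewrite mem_iota.
Qed.

Lemma aut_Klein q c M N :
  dihedral_cert q c M N 2 -> Aut q c \isog setX (Zp 2) (Zp 2).
Proof.
move/aut_dihedral=> isoA.
apply: (@isog_trans _ _ _ (AutG q c) [set: 'D_4]%G (setX_group _ _) isoA).
by rewrite isog_sym; apply: Klein_dihedral.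
Qed.

(** Conjugation by [T] embeds the permutation matrices in the projective group. The transpositions
    [tperm ord0 j] generate and land on the automorphisms [rho (M j)], so the image lies in the
    group, and it has 24 elements. *)
Lemma aut_symmetric q c (T : 'M[K]_4) (M : 'I_4 -> mat Z) :
  T \in unitmx -> (size (autos q c) <= 24)%N ->
  (forall j, fixes zp11 q c (M j)) ->
  (forall j, T *m mx4 (mmap red (M j)) = perm_mx (tperm ord0 j) *m T)%R ->
  Aut q c \isog [set: 'S_4].
Proof.
move=> UT le24 fixM TM.
have UP (s : 'S_4) : (perm_mx s : 'M[K]_4) \in unitmx by exact: unitmx_perm.
have UM j : invertible (M j).
  rewrite /invertible; have : (T *m mx4 (mmap red (M j)))%R \in unitmx.
    by rewrite TM unitmx_mul UT UP.
  by rewrite unitmx_mul => /andP[].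
pose f (s : 'S_4) : coset_of scal := mxPGL (perm_mx s) ^ mxPGL T.
have fM : {in [set: 'S_4] &, {morph f : s t / s * t}}.
  move=> s t _ _; rewrite /f -conjMg; congr (_ ^ _).
  by rewrite perm_mxM; apply: mxPGL_mul.
pose fm := Morphism fM.
have f_rho j : f (tperm ord0 j) = rho (M j).
  rewrite /f conjgE -(mxPGL_mul (UP _) UT) -TM (mxPGL_mul UT (UM j)).
  exact: mulKg.
have injf : 'injm fm.
  apply/injmP => s t _ _ /conjg_inj/(mxPGL_eq (UP s) (UP t))[a st].
  (* This entry is 1 on the left, and on the right it is [a] if [t i = s i] and 0 otherwise. *)
  apply/permP => i; apply/eqP; move/matrixP/(_ i (s i)): st.
  rewrite !mxE eqxx eq_sym; case: eqP => // _ /eqP.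
  by rewrite mulr0 oner_eq0.
have imA : fm @* [set: 'S_4] \subset AutG q c.
  rewrite sub_morphim_pre // -(gen_tperm ord0) gen_subG.
  apply/subsetP => _ /imsetP[j _ ->]; rewrite !inE /= f_rho.
  exact: rho_aut.
rewrite -[Aut q c]/(gval (AutG q c)).
have <- : fm @* [set: 'S_4] = AutG q c.
  apply/eqP; rewrite eqEcard imA (card_injm injf) // cardsT card_Sn.
  exact: leq_trans (card_aut q c) le24.
by rewrite isog_sym sub_isog.
Qed.

End Isomorphisms.

(** * The symmetric group of the twelfth curve *)

Section OctahedralCase.

Local Open Scope ring_scope.

Local Notation K := 'F_11.

Definition natmx (L : seq (seq nat)) : 'M[K]_4 :=
  \matrix_(i, j) (nth 0%N (nth [::] L i) j)%:R.

(* The nine entries are listed column by column. *)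
Definition natmat (s : seq nat) : mat Z :=
  let e i := (nth 0%N s i)%:R in
  ((e 0, e 1, e 2), (e 3, e 4, e 5), (e 6, e 7, e 8))%N.

(* Row i is the linear form x + n_i, where n_1, .., n_4 in y, z, w have sum 0   *)
(* and form an orbit of the stabilizer of P_12.                                 *)
Definition S4_basis : 'M[K]_4 :=
  natmx [:: [:: 1; 1; 0; 4]; [:: 1; 5; 0; 3]; [:: 1; 8; 3; 2]; [:: 1; 8; 8; 2]]%N.

Lemma S4_basis_unit : S4_basis \in unitmx.
Proof.
(* The inverse of [S4_basis] modulo 11. *)
pose T' := natmx [:: [:: 3; 3; 3; 3]; [:: 10; 2; 5; 5]; [:: 0; 0; 2; 9];
                     [:: 8; 7; 9; 9]]%N.
have /mulmx1_unit[UT _] : S4_basis *m T' = 1%:M; last exact: UT.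
apply/matrixP; elim/ord4_ind; elim/ord4_ind; rewrite mxE sum4 !mxE /=.
all: apply/eqP; vm_compute; reflexivity.
Qed.

(** Entry [j] exchanges the linear forms in rows 0 and [j] of [S4_basis]; entry 0 is the identity
    because [tperm ord0 ord0] is trivial. *)
Definition S4_reflections : seq (mat Z) :=
  [:: mid Z; natmat [:: 0; 0; 4; 0; 1; 0; 3; 0; 0];
      natmat [:: 3; 8; 4; 4; 6; 8; 1; 4; 3];
      natmat [:: 3; 3; 4; 7; 6; 3; 1; 7; 3]]%N.

Lemma S4_reflectionsP (j : 'I_4) :
  S4_basis *m mx4 (mmap red (nth (mid Z) S4_reflections j)) =
  perm_mx (tperm ord0 j) *m S4_basis.
Proof.
rewrite -row_permE; apply/matrixP; elim/ord4_ind: j; elim/ord4_ind; elim/ord4_ind;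
  rewrite !mxE permE sum4 !mxE /=.
all: apply/eqP; vm_compute; reflexivity.
Qed.

End OctahedralCase.

(** * Coefficient lists of the seventeen cubics *)

Section Equations.

Local Open Scope ring_scope.

Lemma P1_cubic : P1_Dege = cubic [::]%N
  [:: 1; 0; 0; 0; 0; 0; 0; 0; 0; 1]%N.
Proof. by rewrite /P1_Dege /cubic /cform /=; ring. Qed.

Lemma P2_cubic : P2_Dege = cubic [::]%N
  [:: 1; 0; 0; 0; 0; 0; 0; 0; 0; 2]%N.
Proof. by rewrite /P2_Dege /cubic /cform /=; ring. Qed.

Lemma P3_cubic : P3_Dege = cubic [::]%N
  [:: 1; 0; 0; 0; 0; 0; 1; 0; 0; 5]%N.
Proof. by rewrite /P3_Dege /cubic /cform /=; ring. Qed.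

Lemma P4_cubic : P4_Dege = cubic [:: 0; 0; 0; 0; 0; 1]%N
  [:: 1; 0; 0; 0; 0; 0; 0; 0; 0; 0]%N.
Proof. by rewrite /P4_Dege /cubic /cform /=; ring. Qed.

Lemma P5_cubic : P5_Dege = cubic [:: 0; 0; 0; 0; 0; 2]%N
  [:: 1; 0; 0; 0; 0; 0; 0; 0; 0; 0]%N.
Proof. by rewrite /P5_Dege /cubic /cform /=; ring. Qed.

Lemma P6_cubic : P6_Dege = cubic [:: 0; 0; 0; 0; 1; 0]%N
  [:: 1; 0; 0; 0; 0; 0; 7; 0; 0; 1]%N.
Proof. by rewrite /P6_Dege /cubic /cform /=; ring. Qed.

Lemma P7_cubic : P7_Dege = cubic [:: 0; 1; 0; 0; 0; 1]%N
  [:: 1; 0; 0; 0; 0; 0; 5; 0; 0; 4]%N.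
Proof. by rewrite /P7_Dege /cubic /cform /=; ring. Qed.

Lemma P8_cubic : P8_Dege = cubic [:: 0; 1; 0; 0; 0; 6]%N
  [:: 1; 0; 0; 0; 0; 0; 8; 0; 0; 8]%N.
Proof. by rewrite /P8_Dege /cubic /cform /=; ring. Qed.

Lemma P9_cubic : P9_Dege = cubic [::]%N
  [:: 5; 0; 0; 2; 0; 0; 1; 0; 1; 4]%N.
Proof. by rewrite /P9_Dege /cubic /cform /=; ring. Qed.

Lemma P10_cubic : P10_Dege = cubic [::]%N
  [:: 1; 0; 0; 8; 0; 0; 0; 1; 0; 2]%N.
Proof. by rewrite /P10_Dege /cubic /cform /=; ring. Qed.

Lemma P11_cubic : P11_Dege = cubic [::]%N
  [:: 2; 0; 0; 2; 0; 0; 4; 1; 0; 3]%N.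
Proof. by rewrite /P11_Dege /cubic /cform /=; ring. Qed.

Lemma P12_cubic : P12_Dege = cubic [::]%N
  [:: 2; 0; 0; 4; 0; 0; 0; 1; 0; 10]%N.
Proof. by rewrite /P12_Dege /cubic /cform /=; ring. Qed.

Lemma P13_cubic : P13_Dege = cubic [::]%N
  [:: 2; 0; 0; 4; 0; 0; 1; 1; 1; 7]%N.
Proof. by rewrite /P13_Dege /cubic /cform /=; ring. Qed.

Lemma P14_cubic : P14_Dege = cubic [:: 1; 7; 0; 8; 8; 2]%N
  [:: 2; 0; 0; 4; 0; 0; 1; 1; 1; 7]%N.
Proof. by rewrite /P14_Dege /cubic /cform /=; ring. Qed.

Lemma P15_cubic : P15_Dege = cubic [::]%N
  [:: 5; 0; 0; 3; 0; 0; 5; 1; 1; 10]%N.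
Proof. by rewrite /P15_Dege /cubic /cform /=; ring. Qed.

Lemma P16_cubic : P16_Dege = cubic [::]%N
  [:: 6; 0; 0; 2; 0; 0; 6; 1; 1; 6]%N.
Proof. by rewrite /P16_Dege /cubic /cform /=; ring. Qed.

Lemma P17_cubic : P17_Dege = cubic [::]%N
  [:: 10; 0; 0; 6; 0; 0; 7; 1; 1; 0]%N.
Proof. by rewrite /P17_Dege /cubic /cform /=; ring. Qed.

End Equations.

(** * Certificates for the seventeen groups *)

Local Open Scope group_scope.

Lemma aut_P1 : curve_aut Q_Dege P1_Dege \isog setX (Zp 2) (Zp 2).
Proof.
rewrite P1_cubic; apply: (@aut_Klein _ _
  (* The exchange of $y$ and $w$, then the same composed with $z \mapsto -z$. *)
  (natmat [:: 0; 0; 1; 0; 1; 0; 1; 0; 0]%N)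
  (natmat [:: 0; 0; 1; 0; 10; 0; 1; 0; 0]%N)).
by vm_compute.
Qed.

Lemma aut_P2 : curve_aut Q_Dege P2_Dege \isog setX (Zp 2) (Zp 2).
Proof.
rewrite P2_cubic; apply: (@aut_Klein _ _
  (natmat [:: 0; 0; 8; 0; 1; 0; 7; 0; 0]%N)
  (natmat [:: 0; 0; 8; 0; 10; 0; 7; 0; 0]%N)).
by vm_compute.
Qed.

Lemma aut_P3 : curve_aut Q_Dege P3_Dege \isog setX (Zp 2) (Zp 2).
Proof.
rewrite P3_cubic; apply: (@aut_Klein _ _
  (natmat [:: 0; 0; 4; 0; 1; 0; 3; 0; 0]%N)
  (natmat [:: 7; 5; 10; 4; 7; 5; 2; 4; 7]%N)).
by vm_compute.
Qed.

Lemma aut_P4 : curve_aut Q_Dege P4_Dege \isog Zp 2.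
Proof.
rewrite P4_cubic.
(* The symmetry $z \mapsto -z$: the cubic is free of $z$ and $Q$ is even in it. *)
apply: (@aut_cyclic _ _ (natmat [:: 1; 0; 0; 0; 10; 0; 0; 0; 1]%N) 2).
by vm_compute.
Qed.

Lemma aut_P5 : curve_aut Q_Dege P5_Dege \isog Zp 2.
Proof.
rewrite P5_cubic.
apply: (@aut_cyclic _ _ (natmat [:: 1; 0; 0; 0; 10; 0; 0; 0; 1]%N) 2).
by vm_compute.
Qed.

Lemma aut_P6 : curve_aut Q_Dege P6_Dege \isog [1 'S_1]%G.
Proof.
rewrite P6_cubic; apply: aut_trivial.
by vm_compute.
Qed.

Lemma aut_P7 : curve_aut Q_Dege P7_Dege \isog Zp 2.
Proof.
rewrite P7_cubic.
apply: (@aut_cyclic _ _ (natmat [:: 7; 9; 6; 1; 7; 9; 7; 1; 7]%N) 2).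
by vm_compute.
Qed.

Lemma aut_P8 : curve_aut Q_Dege P8_Dege \isog [1 'S_1]%G.
Proof.
rewrite P8_cubic; apply: aut_trivial.
by vm_compute.
Qed.

Lemma aut_P9 : curve_aut Q_Dege P9_Dege \isog Zp 6.
Proof.
rewrite P9_cubic.
apply: (@aut_cyclic _ _ (natmat [:: 6; 3; 2; 5; 7; 4; 8; 3; 7]%N) 6).
by vm_compute.
Qed.

Lemma aut_P10 : curve_aut Q_Dege P10_Dege \isog 'D_12.
Proof.
rewrite P10_cubic; apply: (@aut_dihedral _ _
  (natmat [:: 0; 0; 8; 0; 10; 0; 7; 0; 0]%N)
  (natmat [:: 3; 5; 5; 2; 6; 5; 3; 2; 3]%N) 6).
by vm_compute.
Qed.

Lemma aut_P11 : curve_aut Q_Dege P11_Dege \isog 'D_12.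
Proof.
rewrite P11_cubic; apply: (@aut_dihedral _ _
  (natmat [:: 0; 0; 2; 0; 1; 0; 6; 0; 0]%N)
  (natmat [:: 5; 2; 4; 3; 0; 2; 9; 3; 5]%N) 6).
by vm_compute.
Qed.

Lemma aut_P12 : curve_aut Q_Dege P12_Dege \isog [set: 'S_4].
Proof.
rewrite P12_cubic.
apply: (aut_symmetric (M := fun j => nth (mid Z) S4_reflections j))
  S4_basis_unit _ _ S4_reflectionsP.
  by vm_compute.
by elim/ord4_ind; vm_compute.
Qed.

Lemma aut_P13 : curve_aut Q_Dege P13_Dege \isog Zp 4.
Proof.
rewrite P13_cubic.
apply: (@aut_cyclic _ _ (natmat [:: 0; 0; 3; 0; 1; 1; 4; 7; 9]%N) 4).
by vm_compute.
Qed.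

Lemma aut_P14 : curve_aut Q_Dege P14_Dege \isog Zp 2.
Proof.
rewrite P14_cubic.
apply: (@aut_cyclic _ _ (natmat [:: 1; 10; 5; 4; 8; 10; 3; 4; 1]%N) 2).
by vm_compute.
Qed.

Lemma aut_P15 : curve_aut Q_Dege P15_Dege \isog Zp 6.
Proof.
rewrite P15_cubic.
apply: (@aut_cyclic _ _ (natmat [:: 8; 5; 6; 7; 2; 10; 10; 3; 10]%N) 6).
by vm_compute.
Qed.

Lemma aut_P16 : curve_aut Q_Dege P16_Dege \isog Zp 3.
Proof.
rewrite P16_cubic.
apply: (@aut_cyclic _ _ (natmat [:: 0; 0; 1; 0; 10; 8; 1; 8; 1]%N) 3).
by vm_compute.
Qed.

Lemma aut_P17 : curve_aut Q_Dege P17_Dege \isog 'D_8.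
Proof.
rewrite P17_cubic; apply: (@aut_dihedral _ _
  (natmat [:: 7; 2; 6; 2; 9; 2; 6; 2; 7]%N)
  (natmat [:: 8; 8; 7; 4; 5; 8; 10; 4; 8]%N) 4).
by vm_compute.
Qed.

(* 'D_m is the dihedral group of order m, i.e. of degree m / 2. *)
Theorem theorem4p1p3 :
  curve_aut Q_Dege P1_Dege \isog setX (Zp 2) (Zp 2) /\
  curve_aut Q_Dege P2_Dege \isog setX (Zp 2) (Zp 2) /\
  curve_aut Q_Dege P3_Dege \isog setX (Zp 2) (Zp 2) /\
  curve_aut Q_Dege P4_Dege \isog Zp 2 /\
  curve_aut Q_Dege P5_Dege \isog Zp 2 /\
  curve_aut Q_Dege P6_Dege \isog [1 'S_1]%G /\
  curve_aut Q_Dege P7_Dege \isog Zp 2 /\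
  curve_aut Q_Dege P8_Dege \isog [1 'S_1]%G /\
  curve_aut Q_Dege P9_Dege \isog Zp 6 /\
  curve_aut Q_Dege P10_Dege \isog 'D_12 /\
  curve_aut Q_Dege P11_Dege \isog 'D_12 /\
  curve_aut Q_Dege P12_Dege \isog [set: 'S_4] /\
  curve_aut Q_Dege P13_Dege \isog Zp 4 /\
  curve_aut Q_Dege P14_Dege \isog Zp 2 /\
  curve_aut Q_Dege P15_Dege \isog Zp 6 /\
  curve_aut Q_Dege P16_Dege \isog Zp 3 /\
  curve_aut Q_Dege P17_Dege \isog 'D_8.
Proof.
exact: (conj aut_P1 (conj aut_P2 (conj aut_P3 (conj aut_P4 (conj aut_P5
  (conj aut_P6 (conj aut_P7 (conj aut_P8 (conj aut_P9 (conj aut_P10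
  (conj aut_P11 (conj aut_P12 (conj aut_P13 (conj aut_P14 (conj aut_P15
  (conj aut_P16 aut_P17)))))))))))))))).
Qed.
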